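(* Let $\beta\in[0,1]$ and let $P\in S(\beta)$. If all the roots of $P$ lie on a line (in the complex plane), then $d(P,\beta) \le 1-\frac{1}{2}\beta(1-\beta)$.
   Context: For a complex number $\beta$ with $|\beta|\le 1$, $S(\beta)$ denotes the set of polynomials of degree at least $2$ with complex coefficients, having all their roots in the closed unit disk $\{z\in\mathbb{C}: |z|\le 1\}$ and at least one root at $\beta$. For a polynomial $P$ (of degree at least $2$), $d(P,\beta)$ denotes the distance between $\beta$ and the closest root of the derivative $P'$, i.e. $d(P,\beta)=\min\{|\beta-\zeta| : P'(\zeta)=0\}$. *)

(* Defs.v *)
From mathcomp Require Import all_boot all_order all_algebra.
From mathcomp Require Import classical_sets boolp reals.
From mathcomp Require Import complex.

Set Implicit Arguments.
Unset Strict Implicit.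
Unset Printing Implicit Defensive.

Import Order.TTheory GRing.Theory Num.Theory.
Import ComplexField.Normc.

Local Open Scope ring_scope.
Local Open Scope complex_scope.
Local Open Scope classical_set_scope.

(* [size P] is the degree plus one; [normc z : R] is the modulus of [z : R[i]]
   (whereas [`|z|] lives in [R[i]]). The set is empty unless [normc beta <= 1]. *)
Definition S_class (R : realType) (beta : R[i]) : set {poly R[i]} :=
  [set P : {poly R[i]} | [/\ (2 < size P)%N,
               (forall z : R[i], root P z -> normc z <= 1) &
               root P beta]].

(* The infimum is a minimum as soon as [P] has degree at least 2:
   see [crit_dist_min]. *)
Definition crit_dist (R : realType) (P : {poly R[i]}) (beta : R[i]) : R :=
  inf [set normc (beta - zeta) | zeta in [set zeta | root P^`() zeta]].

Definition is_line (R : realType) (L : set R[i]) : Prop :=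
  exists a b : R[i], b != 0 /\ L = [set a + t%:C * b | t in [set: R]].

Lemma crit_dist_min (R : realType) (P : {poly R[i]}) (beta : R[i]) :
  (2 < size P)%N ->
  exists zeta, [/\ root P^`() zeta,
                   crit_dist P beta = normc (beta - zeta) &
                   forall w, root P^`() w ->
                     normc (beta - zeta) <= normc (beta - w)].
Proof.
move=> sP.
have sP' : size P^`() = (size P).-1.
  by apply: size_poly_eq; rewrite prednK -?lt0n ?mulrn_eq0 ?lead_coef_eq0
    -?size_poly_eq0; case: (size P) sP => [|[|[]]].
have nz : P^`() != 0 by rewrite -size_poly_eq0 sP'; case: (size P) sP => [|[]].
have [r Pr] := closed_field_poly_normal P^`().
have rE w : root P^`() w = (w \in r).
  by rewrite Pr rootZ ?lead_coef_eq0 // root_prod_XsubC.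
have [z0 z0r] : exists z0, root P^`() z0.
  by apply/closed_rootP; rewrite sP'; case: (size P) sP => [|[|[]]].
pose f (i : 'I_(size r)) := normc (beta - r`_i).
have i0P : (index z0 r < size r)%N by rewrite index_mem -rE.
pose i := [arg min_(i < Ordinal i0P) f i]%O.
have minf w : root P^`() w -> f i <= normc (beta - w).
  rewrite rE -index_mem => wr.
  rewrite /i; case: arg_minP => // j _ /(_ (Ordinal wr) isT).
  by rewrite {2}/f /= nth_index // -index_mem.
have ri : root P^`() r`_i by rewrite rE mem_nth.
exists r`_i; split=> //.
apply/eqP; rewrite eq_le; apply/andP; split.
- apply: ge_inf; last by exists r`_i.
  by exists (f i) => _ [w /minf + <-].
- apply: lb_le_inf; first by exists (f i), r`_i.
  by move=> _ [w /minf + <-].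
Qed.

(* Main.v *)
(* Parametrize the line by [beta + t u] with [|u| = 1]: [P] becomes a real
   polynomial [Q = X * H] with real-rooted [H], and a real critical point [x] of
   [Q] gives a root of [P'] at distance [|x|] from [beta]. If [Q'] has no root in
   [[-c, c]], the roots [t] of [H] lie outside, by Rolle, and [X Q' / Q], which
   is [1] at [0], stays positive on [[-c, c]]. Adding its values at [c] and [-c]
   gives [2 c^2 < t^2] for every [t]; when all the [t] are on the same side of
   [0], the value at that end gives [2 c < |t|]. With [c] the claimed bound,
   [2 c^2 > 1], so all [|t| > 1]. On one side of [beta] the unit disk contains
   only [|t| <= 1], so all the [t] are on the other side, and there
   [|t| <= 1 + beta <= 2 c]. *)
Require Import Defs.
From mathcomp Require Import all_boot all_order all_algebra.
From mathcomp Require Import classical_sets boolp reals.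
From mathcomp Require Import complex polyrcf ring lra.

Set Implicit Arguments.
Unset Strict Implicit.
Unset Printing Implicit Defensive.

Import Order.TTheory GRing.Theory Num.Theory.
Import ComplexField.Normc.
Local Open Scope ring_scope.
Local Open Scope complex_scope.

Lemma sum_le_term (R : numDomainType) (s : seq R) (F : R -> R) (t : R) :
  t \in s -> {in s, forall v, F v <= 0} -> \sum_(v <- s) F v <= F t.
Proof.
move=> ts Fle; rewrite (perm_big _ (perm_to_rem ts)) big_cons -subr_ge0 opprD.
rewrite addNKr oppr_ge0 big_seq sumr_le0 // => v /mem_rem; exact: Fle.
Qed.

Lemma horner_deriv_prod_XsubC (F : fieldType) (s : seq F) (x : F) :
  x \notin s ->
  (\prod_(t <- s) ('X - t%:P))^`().[x] =
  (\prod_(t <- s) ('X - t%:P)).[x] * \sum_(t <- s) (x - t)^-1.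
Proof.
elim: s => [|t s IH]; first by rewrite !big_nil derivC hornerC mulr0.
rewrite inE negb_or => /andP[xt xs]; rewrite !big_cons derivM derivXsubC mul1r.
rewrite !hornerE IH // mulrDr mulrA; congr (_ + _).
by rewrite mulrAC divff ?mul1r // subr_eq0.
Qed.

Definition critfree (R : rcfType) (c : R) (Q : {poly R}) :=
  forall x, `|x| <= c -> ~~ root Q^`() x.

(** Rolle between [0] and [t] would put a critical point of modulus at most [c]; if [t = 0], then
    [0] is a double root and itself critical. *)
Lemma root_out_critfree (R : rcfType) (s : seq R) (c t : R) :
  critfree c ('X * \prod_(t <- s) ('X - t%:P)) -> 0 < c -> t \in s -> c < `|t|.
Proof.
set Q := 'X * _ => noroot c0 ts; rewrite ltNge; apply/negP=> tc.
have Q0 : Q.[0] = 0 by rewrite hornerM hornerX mul0r.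
have Qt : Q.[t] = 0.
  by rewrite hornerM (rootP (_ : root (\prod_(u <- s) _) t)) ?mulr0 ?root_prod_XsubC.
have [tn|tp|t0] := ltgtP t 0.
- have [x /[!in_itv] /andP[xt x0] /eqP] := poly_rolle tn (etrans Qt (esym Q0)).
  apply/negP/noroot; apply: le_trans tc.
  by rewrite !ltr0_norm // lerN2 ltW.
- have [x /[!in_itv] /andP[x0 xt] /eqP] := poly_rolle tp (etrans Q0 (esym Qt)).
  apply/negP/noroot; apply: le_trans tc.
  by rewrite !gtr0_norm // ltW.
- have /negP := noroot 0 ltac:(by rewrite normr0 ltW).
  apply; rewrite rootE derivM derivX mul1r hornerD hornerM hornerX mul0r addr0.
  by rewrite -rootE root_prod_XsubC -t0.
Qed.

(** The right-hand side is [x Q'(x) / Q(x)] extended by its value 1 at [0]: it cannot change sign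
    where neither [Q'] nor the product vanishes. *)
Lemma logderiv_critfree (R : rcfType) (s : seq R) (c x : R) :
  critfree c ('X * \prod_(t <- s) ('X - t%:P)) -> 0 < c -> `|x| <= c ->
  0 < 1 + \sum_(t <- s) x / (x - t).
Proof.
move=> noroot c0 xc.
have Hn y : `|y| <= c -> y \notin s.
  move=> yc; apply/negP => /(root_out_critfree noroot c0).
  by rewrite ltNge yc.
move: noroot; set H := \prod_(t <- s) _; set Q := 'X * H => noroot.
have Hr y : `|y| <= c -> ~~ root H y by rewrite root_prod_XsubC; exact: Hn.
(* Multiplying by the square of [H] clears the denominators and keeps the sign, so the intermediate
   value theorem applies to the polynomial [Q' H]. *)
have QE y : `|y| <= c ->
    (Q^`() * H).[y] = H.[y] ^+ 2 * (1 + \sum_(t <- s) y / (y - t)).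
  move=> /Hn yc; rewrite hornerM derivM derivX mul1r hornerD [('X * _).[y]]hornerM.
  rewrite hornerX horner_deriv_prod_XsubC // -mulr_sumr -/H; ring.
have QH0 : 0 < (Q^`() * H).[0].
  rewrite QE ?normr0 1?ltW // big1 ?addr0 ?mulr1 => [|t _]; last by rewrite mul0r.
  by rewrite exprn_even_gt0 //=; apply: Hr; rewrite normr0 ltW.
have nr : {in `[-c, c], forall y, ~~ root (Q^`() * H) y}.
  by move=> y; rewrite in_itv /= -ler_norml rootM negb_or => yc; rewrite noroot ?Hr.
have itv y : `|y| <= c -> y \in `[-c, c] by rewrite in_itv /= -ler_norml.
have := noroot_noivt nr (itv 0 _) (itv x xc); rewrite normr0 => /(_ (ltW c0)).
rewrite (pmulr_rgt0 _ QH0) QE // pmulr_rgt0 // exprn_even_gt0 //=.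
exact: Hr.
Qed.

(** The contributions of a root [v] at [c] and [-c] add up to [2c^2 / (c^2 - v^2)], which is
    negative since [c < |v|]. Dropping all of them but that of [t] leaves
    [0 < 2 + 2c^2 / (c^2 - t^2)]. *)
Lemma critfree_two_sided (R : rcfType) (s : seq R) (c t : R) :
  critfree c ('X * \prod_(t <- s) ('X - t%:P)) -> 0 < c -> t \in s ->
  2 * c ^+ 2 < t ^+ 2.
Proof.
move=> noroot c0 ts.
have out v : v \in s -> c ^+ 2 < v ^+ 2.
  move=> /(root_out_critfree noroot c0) cv.
  by rewrite -(real_normK (num_real v)) ltrXn2r // ltW.
have cc : `|c| <= c by rewrite gtr0_norm.
have := logderiv_critfree noroot c0 cc.
rewrite -normrN in cc; have := logderiv_critfree noroot c0 cc.
move=> /addr_gt0 h /h{h}; rewrite addrACA -big_split /=.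
rewrite (eq_big_seq (fun v => 2 * c ^+ 2 / (c ^+ 2 - v ^+ 2))) => [|v /out cv]; last first.
  have : (c - v) * (c + v) != 0 by apply/eqP; nra.
  rewrite mulf_eq0 negb_or => /andP[h1 h2].
  have h3 : - c - v != 0 by rewrite -opprD oppr_eq0.
  have h4 : c ^+ 2 - v ^+ 2 != 0 by rewrite subr_sqr mulf_neq0.
  by field; rewrite h1 h3 h4.
have le0 : {in s, forall v, 2 * c ^+ 2 / (c ^+ 2 - v ^+ 2) <= 0}.
  by move=> v /out cv; rewrite pmulr_rle0 ?invr_le0 ?subr_le0 1?ltW // mulr_gt0 ?exprn_gt0.
have := sum_le_term ts le0; set S := \sum_(_ <- _) _ => ST S0.
have {ST S0} : 0 < 2 + 2 * c ^+ 2 / (c ^+ 2 - t ^+ 2) by lra.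
have ct := out _ ts.
rewrite -(ltr_nM2r (_ : c ^+ 2 - t ^+ 2 < 0)) ?subr_lt0 // mul0r mulrDl divfK; last first.
  by rewrite lt_eqF // subr_lt0.
lra.
Qed.

(** At the end [x] on the side of the roots every [x / (x - v)] is negative, so keeping only [t]
    gives [0 < 1 + x / (x - t)], that is [2c^2 < x t]. *)
Lemma critfree_one_sided (R : rcfType) (s : seq R) (c x t : R) :
  critfree c ('X * \prod_(t <- s) ('X - t%:P)) -> 0 < c -> t \in s ->
  `|x| = c -> {in s, forall v, 0 < x * v} -> 2 * c < `|t|.
Proof.
move=> noroot c0 ts xc pos.
have x2 : x ^+ 2 = c ^+ 2 by rewrite -xc real_normK ?num_real.
have neg v : v \in s -> x * v > c ^+ 2.
  move=> vs; have /(root_out_critfree noroot c0) cv := vs.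
  by rewrite -(gtr0_norm (pos _ vs)) normrM xc expr2 ltr_pM2l.
have le0 : {in s, forall v, x / (x - v) <= 0}.
  move=> v /neg cv.
  (* Extending the fraction by [x] treats both ends [c] and [-c] at once. *)
  have -> : x / (x - v) = c ^+ 2 / (x ^+ 2 - x * v).
    have h : x * (x - v) != 0 by apply/eqP; lra.
    move: (h); rewrite mulf_eq0 negb_or => /andP[h1 h2].
    by rewrite -x2 expr2 -mulrBr invfM mulrA -[x * x * _]mulrA mulfV ?mulr1.
  by rewrite pmulr_rle0 ?invr_le0 ?exprn_gt0 //; lra.
have := sum_le_term ts le0; set S := \sum_(_ <- _) _ => ST.
have := logderiv_critfree noroot c0 (_ : `|x| <= c).
rewrite xc lexx => /(_ isT) S0.
have {ST S0} : 0 < 1 + x / (x - t) by rewrite (lt_le_trans S0) // lerD2l.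
have ct := neg _ ts.
have h : x * (x - t) != 0 by apply/eqP; lra.
move: h; rewrite mulf_eq0 negb_or => /andP[h1 h2].
have -> : 1 + x / (x - t) = (2 * c ^+ 2 - x * t) / (c ^+ 2 - x * t).
  by rewrite -x2 expr2 -mulrBr; field; rewrite h2 h1.
rewrite -oppr_lt0 -mulrN -invrN pmulr_llt0 ?invr_gt0; last by lra.
rewrite subr_lt0 -(gtr0_norm (pos _ ts)) normrM xc.
by rewrite expr2 mulrCA ltr_pM2l.
Qed.

Lemma normc_real (R : rcfType) (t : R) : normc t%:C = `|t|.
Proof. by rewrite /= expr0n addr0 sqrtr_sqr. Qed.

Lemma prod_XsubC_comp_line (R : rcfType) (b u : R[i]) (s : seq R) :
  (\prod_(t <- s) ('X - (b + t%:C * u)%:P)) \Po (b%:P + u *: 'X) =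
  u ^+ size s *: map_poly (real_complex R) (\prod_(t <- s) ('X - t%:P)).
Proof.
elim: s => [|t s IH]; first by rewrite !big_nil scale1r !rmorph1.
have fE p : map_poly (real_complex R) (('X - t%:P) * p) =
    ('X - (t%:C)%:P) * map_poly (real_complex R) p.
  by rewrite rmorphM rmorphB /= map_polyX map_polyC.
rewrite !big_cons fE comp_polyM IH comp_polyB comp_polyX comp_polyC.
by rewrite polyCD polyCM -!mul_polyC exprS polyCM; ring.
Qed.

(** Moving the origin to [b] and normalizing the direction makes [|t|] the distance to [b]. *)
Lemma line_unit_param (R : realType) (L : set R[i]) (b : R[i]) :
  is_line L -> L b ->
  exists2 u : R[i], normc u = 1 &
    forall z, L z -> exists t : R, z = b + t%:C * u.
Proof.
move=> [a [v [v0 ->]]] [t0 _ <-].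
have n0 : normc v != 0 by apply: contra v0 => /eqP/eq0_normc/eqP.
have nC : (normc v)%:C != 0 by rewrite (inj_eq (@complexI R) _ 0).
exists (v / (normc v)%:C).
  by rewrite normcM normcV normc_real ger0_norm ?mulfV //; case: (v) => x y; exact: sqrtr_ge0.
move=> _ [t _ <-]; exists ((t - t0) * normc v).
by rewrite rmorphM rmorphB /=; field.
Qed.

Local Open Scope classical_set_scope.

Theorem theorem5 (R : realType) (beta : R) (P : {poly R[i]})
    (hbeta : 0 <= beta <= 1) (hP : S_class beta%:C P)
    (hline : exists L : set R[i], is_line L /\ forall z : R[i], root P z -> L z) :
  crit_dist P beta%:C <= 1 - 2^-1 * beta * (1 - beta).
Proof.
case: hP => sP disk Pb; have [L [Lline PL]] := hline.
have [u u1 uP] := line_unit_param Lline (PL _ Pb).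
have u0 : u != 0.
  by apply: contra_eq_neq u1 => ->; rewrite normc0 eq_sym oner_eq0.
have P0 : P != 0 by rewrite -size_poly_gt0; case: size sP.
have [r Pr] := closed_field_poly_normal P.
have rE z : root P z = (z \in r) by rewrite Pr rootZ ?lead_coef_eq0 // root_prod_XsubC.
set b := beta%:C in Pb uP *.
(* Only one copy of [b] is removed: a multiple root would leave [0] in [s]. The quotients are real,
   so [complex.Re] loses nothing. *)
set r' := rem b r; pose s := [seq complex.Re ((z - b) / u) | z <- r'].
have sE : r' = [seq b + t%:C * u | t <- s].
  rewrite -map_comp -[LHS]map_id; apply/eq_in_map => z /mem_rem; rewrite -rE.
  by move=> /PL/uP[t ->] /=; rewrite addrAC subrr add0r mulfK.
have s_root t : t \in s -> root P (b + t%:C * u).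
  by move=> ts; rewrite rE (@mem_rem _ b) // -/r' sE; apply/mapP; exists t.
pose Q := 'X * \prod_(t <- s) ('X - t%:P).
have PQ : P \Po (b%:P + u *: 'X) =
    (lead_coef P * u ^+ (size s).+1) *: map_poly (real_complex R) Q.
  have -> : Q = \prod_(t <- 0 :: s) ('X - t%:P) by rewrite big_cons subr0.
  rewrite {1}Pr comp_polyZ -scalerA -(prod_XsubC_comp_line b u (0 :: s)).
  congr (_ *: (_ \Po _)).
  rewrite (perm_big _ (perm_to_rem (_ : b \in r))) -?rE // big_cons -/r' {1}sE.
  by rewrite big_map big_cons mul0r addr0.
have crit x : root Q^`() x -> root P^`() (b + x%:C * u).
  move=> /rootP Qx; have /(congr1 (fun p : {poly R[i]} => p^`().[x%:C])) := PQ.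
  rewrite deriv_comp derivZ deriv_map !hornerE horner_map Qx /= !mulr0.
  rewrite horner_comp derivD derivC derivZ derivX !hornerE [u * _]mulrC => /eqP.
  by rewrite !mulf_eq0 (negPf u0) oner_eq0 !orbF.
have [w [wr -> wmin]] := crit_dist_min b sP.
rewrite leNgt; apply/negP => far.
set c := 1 - _ in far.
have [/andP[b0 b1]] := hbeta.
have c0 : 0 < c by rewrite /c; nra.
have noroot : critfree c Q.
  move=> x xc; apply/negP => /crit/wmin; apply/negP; rewrite -ltNge.
  apply: le_lt_trans far; rewrite opprD addNKr normcN normcM u1 mulr1 normc_real.
  exact: xc.
have [t ts] : exists t, t \in s.
  have : (0 < size s)%N.
    rewrite size_map size_rem -?rE //; move: sP; rewrite Pr size_scale ?lead_coef_eq0 //.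
    by rewrite size_prod_XsubC; case: size => [|[]].
  by case: (s) => // t l _; exists t; rewrite mem_head.
(* Here [beta (1 - beta) <= 1/4], so [c >= 7/8] and [2c^2 > 1]. *)
have far_t v : v \in s -> 1 < `|v|.
  move=> /(critfree_two_sided noroot c0) h; rewrite ltNge; apply/negP => v1.
  have : v ^+ 2 <= 1 by rewrite -(real_normK (num_real v)) exprn_ile1.
  by rewrite /c in h; nra.
(* This is [|beta + v u|^2 <= 1], expanded with [|u| = 1]. *)
have sqr_le v : v \in s -> beta ^+ 2 + 2 * v * (beta * complex.Re u) + v ^+ 2 <= 1.
  move=> /s_root/disk; rewrite /b; move: u1; case: (u) => p q /= u1.
  rewrite !mul0r subr0 add0r addr0.
  rewrite -[X in _ <= X]sqrtr1 ler_sqrt // => h.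
  have pq : p ^+ 2 + q ^+ 2 = 1.
    by rewrite -[LHS]sqr_sqrtr ?u1 ?expr1n // addr_ge0 ?sqr_ge0.
  nra.
have t_le : `|t| <= 1 + beta.
  have := le_normcD (b + t%:C * u) (- b).
  rewrite addrAC subrr add0r normcM u1 mulr1 normcN !normc_real (ger0_norm b0).
  by move=> /le_trans; apply; rewrite lerD2r; apply/disk/s_root.
(* The contradiction is [2c < |t| <= 1 + beta], as [2c - (1 + beta) = (1 - beta)^2]. *)
have one_sided x : `|x| = c -> {in s, forall v, 0 < x * v} -> False.
  move=> xc /(critfree_one_sided noroot c0 ts xc).
  by move: t_le; rewrite /c; nra.
(* When [v] and [beta Re u] do not have opposite signs, [sqr_le] forces [v^2 <= 1], against [far_t];
   this fixes the sign of every [v]. *)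
have [Re_ge|Re_lt] := lerP 0 (beta * complex.Re u).
- apply: (one_sided (- c)) => [|v vs]; first by rewrite normrN gtr0_norm.
  rewrite mulNr oppr_gt0 pmulr_rlt0 // ltNge; apply/negP => v0.
  by move: (far_t _ vs) (sqr_le _ vs); rewrite ger0_norm //; nra.
- apply: (one_sided c) => [|v vs]; first by rewrite gtr0_norm.
  rewrite mulr_gt0 // ltNge; apply/negP => v0.
  by move: (far_t _ vs) (sqr_le _ vs); rewrite ler0_norm //; nra.
Qed.
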